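(* Let $\mathcal I$ be a semi-ideal on a compact metrizable space $Z=\bigcup\mathcal I\notin\mathcal I$. If $\mathcal I$ is $\Pi^1_1$-on-$\Sigma^1_1$, then every analytic Haar-$\mathcal I$ set in a non-locally compact Polish group $X$ can be enlarged to (i.e. is contained in) a Borel Haar-$\mathcal I$ set in $X$.
   Context: All groups are Abelian, written additively; a Polish group is a topological group whose underlying space is Polish. A semi-ideal on a set is a nonempty family of subsets closed under taking subsets. A subset $A$ of a Polish group $X$ is Haar-$\mathcal I$ if there is a continuous map $f:Z\to X$ with $f^{-1}(A+x)\in\mathcal I$ for all $x\in X$. $\mathcal I$ is $\Pi^1_1$-on-$\Sigma^1_1$ if for any Polish space $Y$ and any analytic set $A\subset Z\times Y$ the set $\{y\in Y:\{z\in Z:(z,y)\in A\}\in\mathcal I\}$ is coanalytic in $Y$. *)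

(* Defs.v *)
From HB Require Import structures.
From mathcomp Require Import all_boot all_order all_algebra.
From mathcomp Require Import all_classical all_reals all_analysis.

Set Implicit Arguments.
Unset Strict Implicit.
Unset Printing Implicit Defensive.

Local Open Scope classical_set_scope.

Definition homeomorphic (T U : topologicalType) : Prop :=
  exists (f : T -> U) (g : U -> T),
    [/\ continuous f, continuous g, cancel f g & cancel g f].

(* The completeness axiom of [completeType] without the base point that
   structure requires, so that the empty space is allowed. *)
Definition complete_uniform (T : uniformType) : Prop :=
  forall F : set_system T, ProperFilter F -> cauchy F -> exists x : T, F --> x.

Definition metrizable (R : realType) (T : topologicalType) : Prop :=
  exists M : metricType R, homeomorphic M T.

Definition completely_metrizable (R : realType) (T : topologicalType) : Prop :=
  exists M : metricType R, complete_uniform M /\ homeomorphic M T.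

Definition separable (T : topologicalType) : Prop :=
  exists2 D : set T, countable D & dense D.

Definition polish (R : realType) (T : topologicalType) : Prop :=
  separable T /\ completely_metrizable R T.

Definition borel (T : topologicalType) (A : set T) : Prop :=
  <<s @open T >> A.

Definition analytic (R : realType) (T : topologicalType) (A : set T) : Prop :=
  exists (P : topologicalType) (f : P -> T),
    [/\ polish R P, continuous f & range f = A].

Definition coanalytic (R : realType) (T : topologicalType) (A : set T) : Prop :=
  analytic R (~` A).

Definition semi_ideal (T : Type) (I : set (set T)) : Prop :=
  I !=set0 /\ forall A B : set T, A `<=` B -> I B -> I A.

Definition Pi11_on_Sigma11 (R : realType) (Z : topologicalType)
    (I : set (set Z)) : Prop :=
  forall Y : topologicalType, polish R Y ->
  forall A : set (Z * Y), analytic R A ->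
    coanalytic R [set y : Y | I [set z : Z | A (z, y)]].

Definition translate (X : zmodType) (A : set X) (x : X) : set X :=
  [set (a + x)%R | a in A].

Definition Haar (Z : topologicalType) (I : set (set Z))
    (X : topologicalZmodType) (A : set X) : Prop :=
  exists2 f : Z -> X, continuous f & forall x : X, I (f @^-1` translate A x).

(* Main.v *)
From HB Require Import structures.
Require Import Defs.
From mathcomp Require Import all_boot all_order all_algebra.
From mathcomp Require Import all_classical all_reals all_analysis.

Set Implicit Arguments.
Unset Strict Implicit.
Unset Printing Implicit Defensive.

Import Order.TTheory GRing.Theory Num.Theory.

Local Open Scope classical_set_scope.
Local Open Scope ring_scope.

(** The idea is the first reflection theorem: a hereditary property [Phi] of
    sets that is coanalytic on analytic families and holds for an analytic set
    [A] holds for some Borel set containing [A] ([first_reflection]). Fix a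
    continuous [f : Z -> X] witnessing that [A] is Haar-I, and let [Phi B] say
    that the same [f] witnesses that [B] is Haar-I. Heredity comes from the
    semi-ideal, and [Phi] is coanalytic on analytic families because
    [f^-1 (B + v)] depends on [v] in an analytic way and universal quantifiers
    preserve coanalyticity ([coanalytic_Haar_witness]).

    Reflection is usually derived from a coanalytic rank on the complement of
    [A]. Here ordinals are avoided by comparing trees directly. Write [A] as
    the result of the Souslin operation on a decreasing scheme of closed sets
    [F s]. Each point [x] then carries the tree of the finite sequences [s]
    with [x] in [F s], and [x] is in [A] exactly when this tree has an infinite
    branch. Let [D x] be the set of all [y] such that the tree of [x] maps into
    the tree of [y] by a map preserving lengths and initial segments. Three
    facts are used.
    - If [x] is in [A], then [D x] is contained in [A], because an infinite
      branch is sent to an infinite branch ([embeds_branch]).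
    - If [x] is not in [A], then for every [y] one of the trees of [x] and [y]
      maps into the other ([embeds_total]). The set [E x] of the [y] whose tree
      maps into that of [x] is analytic and disjoint from [A], so Lusin's
      theorem ([analytic_separation]) gives a Borel set [B] with [A] contained
      in [B] and [B] disjoint from [E x], hence contained in [D x].
    - The relation [y] in [D x] is analytic ([analytic_embeds]): the map
      between the trees, together with witnesses for membership in the open
      complements of the [F s], is coded by a point of the Baire space on which
      the requirements are closed conditions.

    If [Phi (D x)] holds for some [x] outside [A], then [Phi B] holds for the
    Borel set [B] above. Otherwise [A] is the set of all [x] with [Phi (D x)],
    which is coanalytic; being also analytic, [A] is Borel, and [A] is its own
    enlargement. *)

(** * Polish spaces through explicit distances *)

Definition is_dist (R : realType) (T : Type) (d : T -> T -> R) : Prop :=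
  [/\ forall x, d x x = 0, forall x y, d x y = 0 -> x = y,
      forall x y, d x y = d y x & forall y x z, d x z <= d x y + d y z].

Definition complete_dist (R : realType) (T : Type) (d : T -> T -> R) : Prop :=
  forall F : set_system T, ProperFilter F ->
    (forall e, 0 < e -> exists x, F [set y | d x y < e]) ->
    exists x, forall e, 0 < e -> F [set y | d x y < e].

Definition separable_dist (R : realType) (T : Type) (d : T -> T -> R) : Prop :=
  exists2 D : set T, countable D &
    forall x e, 0 < e -> exists2 y, D y & d x y < e.

(** Completeness and separability are phrased in terms of [d] alone, on a bare
    type: the topology of the space enters only through [dist_topology]. This
    lets one distance be restricted to subsets or pulled back along bijections
    without building a structure at each step. *)
Definition polish_dist (R : realType) (T : Type) (d : T -> T -> R) : Prop :=
  [/\ is_dist d, complete_dist d & separable_dist d].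

Definition dist_topology (R : realType) (T : topologicalType)
    (d : T -> T -> R) : Prop :=
  forall x (U : set T),
    nbhs x U <-> exists2 e, 0 < e & forall y, d x y < e -> U y.

(** The metric space on the points of [T] given by [d]. The axioms are a
    parameter of the type, so that distances obtained inside proofs can be
    used. *)
Definition dist_space (R : realType) (T : choiceType) (d : T -> T -> R)
  (dP : is_dist d) : Type := T.

Section DistSpace.
Variables (R : realType) (T : choiceType) (d : T -> T -> R) (dP : is_dist d).

Let dxx x : d x x = 0. Proof. by case: dP. Qed.
Let deq x y : d x y = 0 -> x = y. Proof. by case: dP => _ + _ _; exact. Qed.
Let dsym x y : d x y = d y x. Proof. by case: dP. Qed.
Let dtri y x z : d x z <= d x y + d y z. Proof. by case: dP. Qed.

HB.instance Definition _ := Choice.on (dist_space dP).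
HB.instance Definition _ :=
  @isMetric.Build R (dist_space dP) d dxx deq dsym dtri.

Lemma dist_space_topology : dist_topology (d : dist_space dP -> _ -> R).
Proof.
move=> x U; rewrite -(metricType_numDomainType.filter_from_mdist_nbhs x).
by split=> -[e e0 xeU]; exists e.
Qed.

Lemma complete_dist_space : complete_dist d ->
  complete_uniform (dist_space dP : uniformType).
Proof.
move=> dc F FF /cauchyP Fc; have [e e0|x xF] := dc F FF.
  have [x Fx] := Fc e e0; exists x.
  by apply: filterS Fx => y; rewrite ballEmdist.
exists x => U /dist_space_topology[e e0 xeU].
by apply: filterS (xF e e0) => y /xeU.
Qed.

End DistSpace.

Arguments dist_space_topology {R T d} dP.

Lemma pullback_mdist (R : realType) (M : metricType R) (T : topologicalType)
    (g : M -> T) (f : T -> M) (d := fun x y => mdist (f x) (f y)) :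
  continuous g -> continuous f -> cancel g f -> cancel f g ->
  is_dist d /\ dist_topology d.
Proof.
move=> gc fc gK fK; split.
  split=> [x|x y /mdist_positivity/(can_inj fK)//|x y|y x z].
  - exact: mdistxx.
  - exact: metric_sym.
  - exact: metric_triangle.
move=> x U; split=> [xU|[e e0 xeU]].
  have : nbhs (f x) (g @^-1` U) by apply: gc; rewrite fK.
  rewrite -(metricType_numDomainType.filter_from_mdist_nbhs (f x)).
  by move=> [e e0 fxeU]; exists e => // y /fxeU/=; rewrite fK.
have xe : nbhs x (f @^-1` ball (f x) e) by apply: fc; exact: nbhsx_ballx.
by apply: filterS xe => y /=; rewrite ballEmdist => /xeU.
Qed.

Lemma polishP (R : realType) (T : topologicalType) :
  polish R T <-> exists2 d : T -> T -> R, polish_dist d & dist_topology d.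
Proof.
split=> [[[D Dc Dd] [M [Mc [g [f [gc fc gK fK]]]]]]|
         [d [dP dc [D Dc Dd]] dT]].
  have [fP fd] := pullback_mdist gc fc gK fK.
  exists (fun x y => mdist (f x) (f y)) => //; split=> //.
  - move=> F FF Fc; have [x xF] : exists x : M, f @ F --> x.
      apply: Mc; apply: cauchy_exP => e e0; have [x Fx] := Fc e e0.
      exists (f x); suff : F (f @^-1` ball (f x) e) by [].
      by apply: filterS Fx => y /=; rewrite ballEmdist.
    exists (g x) => e e0; rewrite gK.
    have Fxe : F (f @^-1` ball x e) by apply: xF; exact: nbhsx_ballx.
    by apply: filterS Fxe => y /=; rewrite ballEmdist.
  - exists D => // x e e0.
    have xe : nbhs x [set y | mdist (f x) (f y) < e] by apply/fd; exists e.
    have [||y [/interior_subset/= xy Dy]] :=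
        Dd [set y | mdist (f x) (f y) < e]°.
    + by exists x.
    + exact: open_interior.
    + by exists y.
split.
  exists D => // O [x Ox] Oo.
  have /dT[e e0 xeO] : nbhs x O by exact: open_nbhs_nbhs.
  by have [y Dy /xeO Oy] := Dd x e e0; exists y.
exists (dist_space dP : metricType R); split; first exact: complete_dist_space.
exists id, id; split=> // x U.
- by move=> /dT/dist_space_topology.
- by move=> /dist_space_topology/dT.
Qed.

Lemma is_dist_ge0 (R : realType) (T : Type) (d : T -> T -> R) x y :
  is_dist d -> 0 <= d x y.
Proof.
move=> [dxx _ dsym dtri]; rewrite -(@pmulrn_lge0 _ _ 2)// mulr2n.
by rewrite -(dxx x) {2}(dsym x y) dtri.
Qed.

Lemma dist_hausdorff (R : realType) (T : topologicalType) (d : T -> T -> R) :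
  is_dist d -> dist_topology d -> hausdorff_space T.
Proof.
move=> dP dT x y xy; have [_ deq dsym dtri] := dP.
apply: deq; apply/eqP; rewrite eq_le is_dist_ge0// andbT leNgt.
apply/negP => d0.
have e0 : 0 < d x y / 2 by rewrite divr_gt0.
have [||z [/= xz yz]] := xy [set z | d x z < d x y / 2]
  [set z | d y z < d x y / 2].
- by apply/dT; exists (d x y / 2).
- by apply/dT; exists (d x y / 2).
have := ltrD xz yz; rewrite -splitr (dsym y).
by rewrite ltNge dtri.
Qed.

Lemma polish_hausdorff (R : realType) (T : topologicalType) :
  polish R T -> hausdorff_space T.
Proof. by move=> /polishP[d [dP _ _]]; exact: dist_hausdorff. Qed.

Lemma polish_prod (R : realType) (T U : topologicalType) :
  polish R T -> polish R U -> polish R (T * U)%type.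
Proof.
move=> /polishP[d [dP dc [D Dc Dd]] dT] /polishP[d' [dP' dc' [D' Dc' Dd']] dT'].
apply/polishP.
exists (fun p q => Num.max (d p.1 q.1) (d' p.2 q.2)); last first.
  move=> [x y] S; split=> [[[V W] /= [/dT[e e0 xV] /dT'[e' e0' yW]] VWS]|].
    exists (Num.min e e'); first by rewrite lt_min e0.
    move=> [x' y']/=.
    rewrite gt_max !lt_min => /andP[/andP[xx' _] /andP[_ yy']].
    by apply: VWS; split; [exact: xV|exact: yW].
  move=> [e e0 xyS]; exists ([set x' | d x x' < e], [set y' | d' y y' < e]).
    by split; [apply/dT|apply/dT']; exists e.
  by move=> [x' y'] [/= xx' yy']; apply: xyS => /=; rewrite gt_max xx'.
have [dxx deq dsym dtri] := dP; have [dxx' deq' dsym' dtri'] := dP'.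
split.
- split=> [x|[x x'] [y y'] /= m0|x y|y x z].
  + by rewrite dxx dxx' maxxx.
  + have xy : d x y <= 0 by rewrite -m0 le_max lexx.
    have xy' : d' x' y' <= 0 by rewrite -m0 le_max lexx orbT.
    by congr pair; [apply: deq|apply: deq']; apply/eqP;
       rewrite eq_le (xy, xy') is_dist_ge0.
  + by rewrite dsym dsym'.
  + rewrite ge_max (le_trans (dtri y.1 _ _)) ?(le_trans (dtri' y.2 _ _))//.
      by rewrite lerD// le_max lexx orbT.
    by rewrite lerD// le_max lexx.
- move=> F FF Fc; have [e e0|x xF] := dc (fst @ F) _.
    have [p Fp] := Fc e e0; exists p.1.
    suff : F [set q | d p.1 q.1 < e] by [].
    by apply: filterS Fp => q /=; rewrite gt_max => /andP[].
  have [e e0|y yF] := dc' (snd @ F) _.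
    have [p Fp] := Fc e e0; exists p.2.
    suff : F [set q | d' p.2 q.2 < e] by [].
    by apply: filterS Fp => q /=; rewrite gt_max => /andP[].
  exists (x, y) => e e0; near=> q => /=; rewrite gt_max; apply/andP.
  by split; near: q; [exact: xF|exact: yF].
- exists (D `*` D'); first exact: countableX.
  move=> [x y] e e0; have [x' Dx' xx'] := Dd x e e0.
  have [y' Dy' yy'] := Dd' y e e0; exists (x', y') => //=.
  by rewrite gt_max xx'.
Unshelve. all: by end_near. Qed.

Lemma small_invn (R : realType) (e : R) : 0 < e -> exists n, n.+1%:R^-1 < e.
Proof.
move=> e0; exists (Num.truncn e^-1).
by rewrite -[ltRHS]invrK ltf_pV2 ?posrE ?invr_gt0// truncnS_gt.
Qed.

Lemma polish_compact (R : realType) (Z : topologicalType) :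
  compact [set: Z] -> metrizable R Z -> polish R Z.
Proof.
move=> Zc [M [g [f [gc fc gK fK]]]]; apply/polishP.
have [fP fd] := pullback_mdist gc fc gK fK.
exists (fun x y => mdist (f x) (f y)) => //; split=> //.
- (* a Cauchy filter converges to any of its cluster points *)
  move=> F FF Fc; have [|x [_ xF]] := Zc F FF; first exact: filterT.
  exists x => e e0.
  have e20 : 0 < e / 2 / 2 by rewrite !divr_gt0.
  have [y Fy] := Fc _ e20.
  have [|z [/= yz xz]] := xF _ [set z | mdist (f x) (f z) < e / 2 / 2] Fy.
    by apply/fd; exists (e / 2 / 2).
  apply: filterS Fy => t /= yt.
  rewrite (le_lt_trans (metric_triangle _ (f z) _))//.
  rewrite (le_lt_trans (lerD (lexx _) (metric_triangle _ (f y) _)))//.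
  rewrite (@metric_sym _ _ (f z)) (lt_trans (ltrD xz (ltrD yz yt)))//.
  rewrite -splitr [ltRHS]splitr ltrD2r ltr_pdivrMr// ltr_pMr ?ltr1n//.
  by rewrite divr_gt0.
- have net (n : nat) : exists s : seq Z, forall x,
      exists2 y, y \in s & mdist (f x) (f y) < n.+1%:R^-1 :> R.
    (* the filter of eventual properties of finite subsets of [Z] *)
    pose F := [set S : set (seq Z) |
      exists s0 : seq Z, forall s : seq Z, {subset s0 <= s} -> S s].
    have FF : ProperFilter F.
      split; first by move=> [s /(_ s)]; exact.
      split=> [|S S' [s sS] [s' sS']|S S' SS' [s sS]].
      - by exists [::].
      - exists (s ++ s') => t ts; split; [apply: sS|apply: sS'] => y ys.
          by apply: ts; rewrite mem_cat ys.
        by apply: ts; rewrite mem_cat ys orbT.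
      - by exists s => t /sS/SS'.
    have /compact_near_coveringP/(_ _ F (fun s x =>
      exists2 y, y \in s & mdist (f x) (f y) < n.+1%:R^-1 :> R) FF) := Zc.
    case=> [x _|s0 s0P]; last first.
      by exists s0 => x; apply: (s0P s0).
    exists ([set y | mdist (f x) (f y) < n.+1%:R^-1 :> R],
            [set s | x \in s]).
      split; first by apply/fd; exists n.+1%:R^-1 => //; rewrite invr_gt0.
      by exists [:: x] => s; apply; rewrite mem_head.
    move=> [y s] [/= xy xs]; exists x => //.
    by rewrite metric_sym.
  have [s sP] := choice net.
  exists (\bigcup_n [set` s n]).
    apply: bigcup_countable => // n _; apply: finite_set_countable.
    exact: finite_seq.
  move=> x e e0; have [n ne] := small_invn e0.
  have [y ys xy] := sP n x; exists y; first by exists n.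
  exact: lt_trans ne.
Qed.

(** * Analytic sets and the Baire space *)

Lemma analytic_image (R : realType) (T U : topologicalType) (A : set T)
    (f : T -> U) : continuous f -> analytic R A -> analytic R (f @` A).
Proof.
move=> fc [P [g [Pp gc <-]]]; exists P, (f \o g); split=> //.
  by move=> p; apply: continuous_comp; [exact: gc|exact: fc].
by rewrite image_comp.
Qed.

(** A closed subset of a Polish space is Polish for the restricted distance.
    That metric space serves as the source of the parametrization. *)
Lemma analytic_closed_image (R : realType) (T U : topologicalType) (C : set T)
    (f : T -> U) :
  polish R T -> closed C -> continuous f -> analytic R (f @` C).
Proof.
move=> /polishP[d [dP dc [D Dc Dd]] dT] Ccl fc.
have [dxx deq dsym dtri] := dP.
pose dC (x y : C) := d (set_val x) (set_val y).
have dCP : is_dist dC.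
  by split=> [x|x y /deq /val_inj//|x y|y x z]; rewrite /dC.
exists (dist_space dCP), (fun x => f (set_val x)); split.
- apply/polishP; exists dC; last exact: dist_space_topology.
  split=> //.
  + move=> F FF Fc; have [e e0|x xF] := dc (set_val @ F) _.
      have [x Fx] := Fc e e0; exists (set_val x).
      by suff : F [set y | dC x y < e] by [].
    have Cx : C x.
      apply: Ccl => V /dT[e e0 xeV].
      have Fe : F [set y : C | d x (set_val y) < e] by exact: xF.
      have [y /= xy] := filter_ex Fe.
      by exists (set_val y); split; [exact: set_valP|exact: xeV].
    by exists (SigSub (mem_set Cx)) => e e0; exact: xF.
  + have [[c0 _]|C0] := pselect ([set: C] !=set0); last first.
      by exists set0 => // x; exfalso; apply: C0; exists x.
    (* one point of [C] in each ball with center in [D] and radius [1/(n+1)]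
       that meets [C] *)
    have /choice[pick pickP] (p : T * nat) : exists c : C,
        (exists c' : C, d p.1 (set_val c') < p.2.+1%:R^-1) ->
        d p.1 (set_val c) < p.2.+1%:R^-1.
      have [[c pc]|pN] :=
        pselect (exists c' : C, d p.1 (set_val c') < p.2.+1%:R^-1).
        by exists c.
      by exists c0.
    exists (pick @` (D `*` [set: nat])).
      by apply: card_le_trans (card_image_le _ _) _; exact: countableX.
    move=> x e e0; have [n ne] := small_invn (divr_gt0 e0 (ltr0n R 2)).
    have n0 : (0 : R) < n.+1%:R^-1 by rewrite invr_gt0.
    have [y Dy xy] := Dd (set_val x) _ n0.
    exists (pick (y, n)); first by exists (y, n).
    have yc : d y (set_val (pick (y, n))) < n.+1%:R^-1.
      by apply: (pickP (y, n)); exists x; rewrite dsym.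
    rewrite (le_lt_trans (dtri y _ _))// [ltRHS]splitr.
    by rewrite (lt_trans (ltrD xy yc))// ltrD.
- move=> x V /fc/dT[e e0 xeV].
  apply: (iffRL (dist_space_topology dCP x ((f \o set_val) @^-1` V))).
  by exists e => // y /xeV.
- apply/seteqP; split=> [_ [x _ <-]|_ [x Cx <-]].
    by exists (set_val x) => //; exact: set_valP.
  by exists (SigSub (mem_set Cx)).
Qed.

Section Baire.
Variable R : realType.

Definition inv_least (P : pred nat) : R :=
  if pselect (exists n, P n) is left exP then (ex_minn exP).+1%:R^-1 else 0.

(** The usual ultrametric: [1/(n+1)] for the least [n] at which the two
    sequences differ, and [0] when they are equal. *)
Definition first_diff (a b : nat -> nat) : R :=
  inv_least (fun n => a n != b n).

Lemma first_diff_ge a b n : a n != b n -> n.+1%:R^-1 <= first_diff a b.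
Proof.
move=> abn; rewrite /first_diff/inv_least.
case: pselect => [H|]; last by case; exists n.
by case: ex_minnP => m _ /(_ n abn) mn; rewrite lef_pV2 ?posrE// ler_nat.
Qed.

Lemma first_diff_lt a b n :
  (forall i, (i <= n)%N -> a i = b i) -> first_diff a b < n.+1%:R^-1.
Proof.
move=> ab; rewrite /first_diff/inv_least.
case: pselect => [H|]; last by rewrite invr_gt0.
case: ex_minnP => m abm _; rewrite ltf_pV2 ?posrE// ltr_nat ltnS ltnNge.
by apply/negP => /ab; exact/eqP.
Qed.

Lemma first_diff_eq a b n i :
  first_diff a b < n.+1%:R^-1 -> (i <= n)%N -> a i = b i.
Proof.
move=> abn ij; apply/eqP; apply: contraLR abn => /first_diff_ge abi.
by rewrite -leNgt; apply: le_trans abi; rewrite lef_pV2 ?posrE// ler_nat.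
Qed.

Lemma first_diff_is_dist : is_dist first_diff.
Proof.
have fd0 a b : 0 <= first_diff a b.
  by rewrite /first_diff/inv_least; case: pselect.
split=> [a|a b ab|a b|b a c].
- rewrite /first_diff/inv_least; case: pselect => [aa|//]; suff : False by [].
  by case: aa => n /eqP.
- apply/funext => n; apply: (@first_diff_eq _ _ n) => //.
  by rewrite ab invr_gt0.
- by congr inv_least; apply/funext => n; rewrite eq_sym.
- rewrite {1}/first_diff/inv_least.
  case: pselect => [H|_]; last by rewrite addr_ge0.
  case: ex_minnP => n acn _; have [abn|abn] := eqVneq (a n) (b n).
    by rewrite ler_wpDl// first_diff_ge// -abn.
  by rewrite ler_wpDr// first_diff_ge.
Qed.

Lemma polish_first_diff : polish_dist first_diff.
Proof.
split; first exact: first_diff_is_dist.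
- move=> F FF Fc.
  have /choice[g gF] n : exists x, F [set y | first_diff x y < n.+1%:R^-1].
    by apply: Fc; rewrite invr_gt0.
  (* a Cauchy filter fixes each coordinate *)
  exists (fun n => g n n) => e e0; have [n ne] := small_invn e0.
  have Fi (i : 'I_n.+1) : F [set y | first_diff (g i) y < i.+1%:R^-1] by [].
  apply: filterS (filter_forall _ Fi) => y yP.
  apply: lt_trans ne; apply: first_diff_lt => i; rewrite -ltnS => i_n.
  by have := yP (Ordinal i_n) => /first_diff_eq; exact.
- (* the sequences that are eventually zero are dense *)
  pose e (s : seq nat) : nat -> nat := nth 0%N s.
  exists (range e).
    exact: card_le_trans (card_image_le _ _) (countableP _).
  move=> x r /small_invn[n nr]; exists (e (mkseq x n.+1)).
    by exists (mkseq x n.+1).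
  apply: lt_trans nr; apply: first_diff_lt => i i_n.
  by rewrite /e nth_mkseq.
Qed.

Definition baire : Type := dist_space first_diff_is_dist.
HB.instance Definition _ := Topological.on baire.

Lemma polish_baire : polish R baire.
Proof.
apply/polishP; exists first_diff; first exact: polish_first_diff.
exact: dist_space_topology.
Qed.

Lemma baire_near (b : baire) n : \forall c \near b, c n = b n.
Proof.
apply/(dist_space_topology first_diff_is_dist).
exists n.+1%:R^-1; first by rewrite invr_gt0.
by move=> c /first_diff_eq -> .
Qed.

End Baire.

Lemma analytic_proj_baire (R : realType) (T : topologicalType)
    (C : set (T * baire R)) :
  polish R T -> closed C -> analytic R [set x | exists b, C (x, b)].
Proof.
move=> Tp Cc.
have -> : [set x | exists b, C (x, b)] = fst @` C.
  apply/seteqP; split=> [x [b Cxb]|_ [[x b] Cxb <-]]; last by exists b.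
  by exists (x, b).
apply: analytic_closed_image => //; first exact: polish_prod (polish_baire R).
by move=> p; exact: cvg_fst.
Qed.

(** * Shrinking schemes and Lusin separation *)

(** The last condition is all that is used of the Polish source of an analytic
    set: along each branch the pieces are empty from some point on, or else
    they shrink to a point of [A]. Every analytic set has such a scheme, made of
    the images of intersections of balls with radii tending to zero. *)
Definition shrinking_scheme (T : topologicalType) (A : set T)
    (S : seq nat -> set T) : Prop :=
  [/\ S [::] = A, forall s, S s = \bigcup_k S (rcons s k) &
      forall a : nat -> nat, (forall n, S (mkseq a n) !=set0) ->
      exists2 x, A x & forall U, nbhs x U -> exists n, S (mkseq a n) `<=` U].

Lemma rcons_decreasing (T : Type) (S : seq nat -> set T) :
  (forall s k, S (rcons s k) `<=` S s) -> forall s u, S (s ++ u) `<=` S s.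
Proof.
move=> Sdec s; elim/last_ind => [|u k IHu]; first by rewrite cats0.
by rewrite -rcons_cat; exact: subset_trans IHu.
Qed.

Lemma mkseq_decreasing (T : Type) (S : seq nat -> set T) (a : nat -> nat) m n :
  (forall s k, S (rcons s k) `<=` S s) -> (m <= n)%N ->
  S (mkseq a n) `<=` S (mkseq a m).
Proof.
move=> Sdec /subnKC <-; elim: (n - m)%N => [|k IHk]; first by rewrite addn0.
by rewrite addnS mkseqS; exact: subset_trans IHk.
Qed.

Lemma scheme_decreasing (T : topologicalType) (A : set T) S :
  shrinking_scheme A S -> forall s k, S (rcons s k) `<=` S s.
Proof.
by move=> [_ SU _] s k; rewrite [X in _ `<=` X]SU; exact: bigcup_sup.
Qed.

Lemma separable_dist_seq (R : realType) (T : Type) (d : T -> T -> R) (x0 : T) :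
  separable_dist d ->
  exists e : nat -> T, forall x r, 0 < r -> exists n, d x (e n) < r.
Proof.
move=> [D Dc Dd].
have [D0|[g Dg]] : D = set0 \/ exists g : nat -> T, D = range g.
  have /pfcard_geP[|] := Dc; first by left.
  by move=> /surjfunPex; right.
- by exists (fun=> x0) => x r /(Dd x)[y]; rewrite D0.
- by exists g => x r /(Dd x)[y]; rewrite Dg => -[n _ <-]; exists n.
Qed.

Lemma analytic_scheme (R : realType) (T : topologicalType) (A : set T) :
  analytic R A -> exists S, shrinking_scheme A S.
Proof.
move=> [P [f [/polishP[d [dP dc dd] dT] fc <-]]].
have [dxx deq dsym dtri] := dP.
have [[p0 _]|P0] := pselect ([set: P] !=set0); last first.
  exists (fun=> set0); split=> [|s|a /(_ 0%N)[]//].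
    by apply/seteqP; split=> // x [p _ _]; exfalso; apply: P0; exists p.
  by rewrite bigcup0.
have [e eP] := separable_dist_seq p0 dd.
pose V (s : seq nat) := [set p | forall i, (i < size s)%N ->
  d (e (nth 0%N s i)) p < i.+1%:R^-1].
exists (fun s => f @` V s); split.
- by apply/seteqP; split=> [_ [p _ <-]|_ [p _ <-]]; exists p.
- move=> s; apply/seteqP; split=> [_ [p sp <-]|_ [k _ [p skp <-]]].
    have [k pk] := eP p (size s).+1%:R^-1 (ltac:(by rewrite invr_gt0)).
    exists k => //; exists p => // i; rewrite size_rcons ltnS leq_eqVlt.
    move=> /predU1P[->|si]; first by rewrite nth_rcons ltnn eqxx dsym.
    by rewrite nth_rcons si; exact: sp.
  exists p => // i si; have := skp i; rewrite size_rcons nth_rcons si; apply.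
  exact: ltnW.
- move=> a aS.
  have /choice[p pP] n : exists p, V (mkseq a n) p.
    by have [_ [p pV _]] := aS n; exists p.
  have Vd n i q : (i < n)%N -> V (mkseq a n) q -> d (e (a i)) q < i.+1%:R^-1.
    by move=> i_n /(_ i); rewrite size_mkseq nth_mkseq//; exact.
  have [r r0|x xp] := dc (p @ \oo) _.
    have [i ir] := small_invn r0; exists (e (a i)).
    exists i.+1 => // n /= i_n; apply: lt_trans ir.
    exact: Vd i_n (pP n).
  exists (f x); first by exists x.
  move=> U /fc/dT[r r0 xrU].
  have [i ir] := small_invn (divr_gt0 (divr_gt0 r0 (ltr0n R 2)) (ltr0n R 2)).
  exists i.+1 => _ [q qV <-]; apply: xrU.
  have r20 : 0 < r / 2 by rewrite divr_gt0.
  have [m _ /(_ (maxn m i.+1))/= ] := xp _ r20.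
  rewrite leq_maxl => /(_ isT) xpm.
  have ipm : d (e (a i)) (p (maxn m i.+1)) < i.+1%:R^-1.
    by apply: Vd (pP _); rewrite leq_maxr.
  have iq : d (e (a i)) q < i.+1%:R^-1 by exact: Vd qV.
  rewrite (le_lt_trans (dtri (p (maxn m i.+1)) _ _))//.
  rewrite (le_lt_trans (lerD (lexx _) (dtri (e (a i)) _ _)))//.
  rewrite [ltRHS]splitr ltrD// (dsym _ (e _)) [ltRHS]splitr ltrD//.
    exact: lt_trans ir.
  exact: lt_trans ir.
Qed.

(** Dependent choice in two trees at once. Separation and the comparison of
    trees both follow the same pattern: a failure at the roots propagates along
    a pair of infinite branches. *)
Lemma paired_branches (Q : seq nat -> seq nat -> Prop) :
  Q [::] [::] ->
  (forall s t, Q s t -> exists k j, Q (rcons s k) (rcons t j)) ->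
  exists a b : nat -> nat, forall n, Q (mkseq a n) (mkseq b n).
Proof.
move=> Q0 Qs.
have /choice[g gP] (p : seq nat * seq nat) : exists kj : nat * nat,
    Q p.1 p.2 -> Q (rcons p.1 kj.1) (rcons p.2 kj.2).
  have [/Qs[k [j kjQ]]|pN] := pselect (Q p.1 p.2); first by exists (k, j).
  by exists (0%N, 0%N).
pose node n := iter n (fun p => (rcons p.1 (g p).1, rcons p.2 (g p).2))
  ([::], [::]).
exists (fun n => (g (node n)).1), (fun n => (g (node n)).2) => n.
suff nodeE : node n =
    (mkseq (fun n => (g (node n)).1) n, mkseq (fun n => (g (node n)).2) n).
  have : Q (node n).1 (node n).2 by elim: n {nodeE} => //= n /gP.
  by rewrite {1 2}nodeE.
elim: n => // n IHn; rewrite !mkseqS {1}/node iterS -/(node n).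
by rewrite {1 3}IHn.
Qed.

Lemma borel_setC (T : topologicalType) (B : set T) : borel B -> borel (~` B).
Proof. by move=> /sigma_algebraCD; rewrite setTD. Qed.

Lemma borel_bigcup (T : topologicalType) (B : nat -> set T) :
  (forall n, borel (B n)) -> borel (\bigcup_n B n).
Proof. exact: sigma_algebra_bigcup. Qed.

Lemma borel_bigcap (T : topologicalType) (B : nat -> set T) :
  (forall n, borel (B n)) -> borel (\bigcap_n B n).
Proof.
move=> Bb; rewrite -[X in borel X]setCK setC_bigcap.
by apply: borel_setC; apply: borel_bigcup => n; exact: borel_setC.
Qed.

Lemma borel_open (T : topologicalType) (B : set T) : open B -> borel B.
Proof. exact: sub_sigma_algebra. Qed.

Definition borel_separated (T : topologicalType) (A B : set T) : Prop :=
  exists2 C, borel C & A `<=` C /\ C `<=` ~` B.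

Lemma borel_separated_bigcup (T : topologicalType) (A B : nat -> set T) :
  (forall k j, borel_separated (A k) (B j)) ->
  borel_separated (\bigcup_k A k) (\bigcup_j B j).
Proof.
move=> AB.
have /choice[C CP] (p : nat * nat) : exists C,
    [/\ borel C, A p.1 `<=` C & C `<=` ~` B p.2].
  by have [C Cb [AC CB]] := AB p.1 p.2; exists C.
exists (\bigcup_k \bigcap_j C (k, j)).
  by apply: borel_bigcup => k; apply: borel_bigcap => j; have [] := CP (k, j).
split=> [x [k _ Akx]|x [k _ Cx] [j _ Bjx]].
  by exists k => // j _; have [_ + _] := CP (k, j); exact.
by have [_ _ /(_ x (Cx j I))] := CP (k, j).
Qed.

(** If [A] and [B] cannot be separated, then there are branches along which the
    pieces of [A] and those of [B] cannot be separated either. These pieces are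
    nonempty, so they shrink to a point of [A] and to a point of [B]. Two
    distinct points have disjoint neighbourhoods, one of which separates small
    enough pieces; hence the two points coincide and [A] meets [B]. *)
Lemma scheme_separation (T : topologicalType) (A B : set T) SA SB :
  hausdorff_space T -> shrinking_scheme A SA -> shrinking_scheme B SB ->
  A `&` B = set0 -> borel_separated A B.
Proof.
move=> TH SAP SBP AB0; have [SA0 SAU SAlim] := SAP; have [SB0 SBU SBlim] := SBP.
apply: contrapT => ABN.
have [||a [b abN]] :=
    @paired_branches (fun s t => ~ borel_separated (SA s) (SB t)).
- by rewrite SA0 SB0.
- move=> s t; apply: contra_notP => /forallNP stS.
  rewrite SAU SBU; apply: borel_separated_bigcup => k j.
  by have /forallNP/(_ j)/contrapT := stS k.
have [n|x Ax xlim] := SAlim a.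
  apply/set0P/negP => /eqP A0; apply: (abN n).
  exists set0; first by apply: borel_open; exact: open0.
  by split; rewrite ?A0; exact: sub0set.
have [n|y By ylim] := SBlim b.
  apply/set0P/negP => /eqP B0; apply: (abN n).
  by exists setT; [apply: borel_open; exact: openT|split; rewrite ?B0 ?setC0].
suff xy : x = y.
  suff : (A `&` B) x by rewrite AB0.
  by split=> //; rewrite xy.
apply: TH => U V /nbhs_interior/xlim[m mU] /ylim[n nV].
apply: contrapT => UV0; apply: (abN (maxn m n)).
exists U°; first by apply: borel_open; exact: open_interior.
split.
  apply: subset_trans mU; apply: mkseq_decreasing (leq_maxl _ _).
  exact: scheme_decreasing SAP.
move=> z /interior_subset Uz.
move=> /(mkseq_decreasing (scheme_decreasing SBP) (leq_maxr m n))/nV Vz.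
by apply: UV0; exists z.
Qed.

Lemma analytic_separation (R : realType) (T : topologicalType) (A B : set T) :
  hausdorff_space T -> analytic R A -> analytic R B ->
  A `&` B = set0 -> borel_separated A B.
Proof.
move=> TH /analytic_scheme[SA SAP] /analytic_scheme[SB SBP].
exact: scheme_separation SAP SBP.
Qed.

Lemma bianalytic_borel (R : realType) (T : topologicalType) (A : set T) :
  hausdorff_space T -> analytic R A -> coanalytic R A -> borel A.
Proof.
move=> TH Aa Ac; have [C Cb [AC CA]] := analytic_separation TH Aa Ac (setICr A).
suff -> : A = C by [].
by apply/seteqP; split=> // x /CA/contrapT.
Qed.

(** [A] results from the Souslin operation on the closures of the pieces: a
    point adherent to all pieces along a branch is the limit of that branch. *)
Lemma scheme_closureP (T : topologicalType) (A : set T) S x :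
  hausdorff_space T -> shrinking_scheme A S ->
  A x <-> exists a : nat -> nat, forall n, closure (S (mkseq a n)) x.
Proof.
move=> TH [S0 SU Slim]; split=> [|[a xS]].
  rewrite -S0 => Sx.
  have [|a [_ aS]] := @paired_branches (fun s _ => S s x) Sx.
    by move=> s _; rewrite SU => -[k _ xk]; exists k, 0%N.
  by exists a => n; exact/subset_closure/aS.
have [n|y Ay ylim] := Slim a.
  by have [z [Sz _]] := xS n setT filterT; exists z.
suff -> : x = y by [].
apply: TH => U V xU /ylim[n nV].
by have [z [/nV Vz Uz]] := xS n U xU; exists z.
Qed.

(** * Comparing trees *)

(** [relabel h s] replaces each entry of [s] by the value of [h] at the initial
    segment of [s] ending with it. Every map of finite sequences that preserves
    lengths and initial segments has this form, for a unique [h] on the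
    nonempty sequences. *)
Fixpoint relabel (h : seq nat -> nat) (s : seq nat) : seq nat :=
  if s is k :: u then h [:: k] :: relabel (fun v => h (k :: v)) u else [::].

Lemma relabel_rcons h s k :
  relabel h (rcons s k) = rcons (relabel h s) (h (rcons s k)).
Proof. by elim: s h => //= j s IHs h; rewrite IHs. Qed.

Lemma relabel_mkseq h (a : nat -> nat) n :
  relabel h (mkseq a n) = mkseq (fun i => h (mkseq a i.+1)) n.
Proof.
by elim: n => // n IHn; rewrite [in LHS]mkseqS relabel_rcons IHn !mkseqS.
Qed.

Lemma eq_relabel h h' s : (forall v, v != [::] -> h v = h' v) ->
  relabel h s = relabel h' s.
Proof.
elim: s h h' => //= k s IHs h h' hh'; rewrite hh'//; congr cons.
by apply: IHs => v _; exact: hh'.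
Qed.

Section Compare.
Variables (T : Type) (F : seq nat -> set T).
Hypothesis Fdec : forall s k, F (rcons s k) `<=` F s.

(** The tree of [x] above [s] maps into the tree of [y] above [t]; the map need
    not be injective. *)
Definition embeds (s t : seq nat) (x y : T) : Prop :=
  exists h, forall u, F (s ++ u) x -> F (t ++ relabel h u) y.

Lemma embeds_branch x y : embeds [::] [::] x y ->
  (exists a : nat -> nat, forall n, F (mkseq a n) x) ->
  exists b : nat -> nat, forall n, F (mkseq b n) y.
Proof.
move=> [h hP] [a aP]; exists (fun i => h (mkseq a i.+1)) => n.
by rewrite -relabel_mkseq; exact/hP/aP.
Qed.

(** If [x] is outside [F s], then its tree above [s] is empty and maps
    anywhere. *)
Lemma not_embeds_mem s t x y : ~ embeds s t x y -> F s x.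
Proof.
apply: contra_notP => sx; exists (fun=> 0%N) => u su; exfalso; apply: sx.
by have := rcons_decreasing Fdec su.
Qed.

(** If the tree above each child of [s] maps into the tree above some child of
    [t], then these maps glue to a map above [s]. *)
Lemma not_embeds_child s t x y : F t y -> ~ embeds s t x y ->
  exists k, forall j, ~ embeds (rcons s k) (rcons t j) x y.
Proof.
move=> ty; apply: contra_notP => /forallNP stN.
have /choice[g gP] (k : nat) : exists jh : nat * (seq nat -> nat),
    forall u, F (rcons s k ++ u) x -> F (rcons t jh.1 ++ relabel jh.2 u) y.
  have /existsNP[j /contrapT[h hP]] := stN k.
  by exists (j, h).
exists (fun v => if v is k :: w then
  if w is [::] then (g k).1 else (g k).2 w else 0%N) => -[|k u] su.
  by rewrite cats0.
rewrite /= (@eq_relabel _ (g k).2); last by case.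
by rewrite -cat_rcons; apply: gP; rewrite cat_rcons.
Qed.

(** When neither tree maps into the other, the failure in both directions passes
    to a child of each root, and so on forever; the nodes visited on the side of
    [x] form an infinite branch of its tree. This replaces the comparison of
    ordinal ranks. *)
Lemma embeds_total x y :
  ~ (exists a : nat -> nat, forall n, F (mkseq a n) x) ->
  embeds [::] [::] x y \/ embeds [::] [::] y x.
Proof.
move=> xN; apply: contrapT => /not_orP[xy yx]; apply: xN.
have [|s t [st ts]|a [b ab]] := @paired_branches
    (fun s t => ~ embeds s t x y /\ ~ embeds t s y x).
- by [].
- have [k kN] := not_embeds_child (not_embeds_mem ts) st.
  have [j jN] := not_embeds_child (not_embeds_mem st) ts.
  by exists k, j.
- by exists a => n; have [/not_embeds_mem] := ab n.
Qed.

End Compare.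

(** The closed sets are [{x | dist (x, C) >= 1/(k+1)}]. *)
Lemma open_Fsigma (R : realType) (T : topologicalType) (C : set T) :
  polish R T -> closed C ->
  exists2 G : nat -> set T, forall k, closed (G k) & ~` C = \bigcup_k G k.
Proof.
move=> /polishP[d [[dxx deq dsym dtri] _ _] dT] Cc.
exists (fun k => [set x | forall y, C y -> k.+1%:R^-1 <= d x y]) => [k|].
  move=> x xk y Cy; rewrite leNgt; apply/negP => xy.
  have e0 : 0 < k.+1%:R^-1 - d x y by rewrite subr_gt0.
  have [z [/= zk xz]] : [set x | forall y, C y -> k.+1%:R^-1 <= d x y] `&`
      [set z | d x z < k.+1%:R^-1 - d x y] !=set0.
    by apply: xk; apply/dT; exists (k.+1%:R^-1 - d x y).
  have := zk y Cy; rewrite leNgt => /negP; apply.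
  by rewrite (le_lt_trans (dtri x _ _))// dsym -ltrBrDr.
apply/seteqP; split=> [x Cx|x [k _ xk] Cx]; last first.
  by have := xk x Cx; rewrite dxx leNgt invr_gt0 ltr0n.
have /dT[e e0 xeC] : nbhs x (~` C).
  by apply: open_nbhs_nbhs; split=> //; exact: closed_openC.
have [k ke] := small_invn e0; exists k => // y Cy.
by rewrite leNgt; apply/negP => /lt_trans/(_ ke)/xeC.
Qed.

Lemma closed_locally_constant (U V : topologicalType) (J : Type) (phi : V -> J)
    (K : J -> set U) :
  (forall b, \forall c \near b, phi c = phi b) -> (forall j, closed (K j)) ->
  closed [set p : U * V | K (phi p.2) p.1].
Proof.
move=> phic Kc [x b] xbK /=; apply: Kc => N xN.
have [[y c] [/= yK [yN cb]]] : [set p : U * V | K (phi p.2) p.1] `&`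
    [set p | N p.1 /\ phi p.2 = phi b] !=set0.
  apply: xbK; exists (N, [set c | phi c = phi b]) => //=.
  by split=> //; exact: phic.
by exists y; rewrite -cb.
Qed.

Lemma relabel_locally_constant (V : topologicalType)
    (h : V -> seq nat -> nat) s :
  (forall v b, \forall c \near b, h c v = h b v) ->
  forall b, \forall c \near b, relabel (h c) s = relabel (h b) s.
Proof.
elim: s h => [|k s IHs] h hc b; first by apply: nearW.
have sc := IHs (fun c v => h c (k :: v)) (fun v => hc (k :: v)) b.
by apply: filterS2 (hc [:: k] b) sc => c /= -> ->.
Qed.

(** A point of the Baire space codes both the map [h] between the trees and, for
    each [s] with [f u] outside [F s], the index [w s] of a closed set that
    contains [f u] and misses [F s]. Each requirement then involves finitely
    many coordinates of the code, and is closed in [u] once these are fixed. *)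
Lemma analytic_embeds (R : realType) (U T : topologicalType)
    (F : seq nat -> set T) (f g : U -> T) :
  polish R U -> polish R T -> continuous f -> continuous g ->
  (forall s, closed (F s)) ->
  analytic R [set u | embeds F [::] [::] (f u) (g u)].
Proof.
move=> Up Tp fc gc Fc.
have /choice[G GP] s : exists G : nat -> set T,
    (forall k, closed (G k)) /\ ~` F s = \bigcup_k G k.
  by have [G Gc GE] := open_Fsigma Tp (Fc s); exists G.
pose h (b : baire R) (s : seq nat) : nat := b (pickle (true, s)).
pose w (b : baire R) (s : seq nat) : nat := b (pickle (false, s)).
pose C s := [set p : U * baire R |
  (G s (w p.2 s) (f p.1)) \/ F (relabel (h p.2) s) (g p.1)].
have -> : [set u | embeds F [::] [::] (f u) (g u)] =
    [set u | exists b, (\bigcap_s C s) (u, b)].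
  apply/seteqP; split=> [u [l lP]|u [b bP]].
    have /choice[m mP] s : exists k, ~ F s (f u) -> G s k (f u).
      have [us|us] := pselect (F s (f u)); first by exists 0%N.
      have : (~` F s) (f u) by [].
      by rewrite (GP s).2 => -[k _ uk]; exists k.
    pose b n := if unpickle n is Some (i, s) then
      if i : bool then l s else m s else 0%N.
    exists b => s _; rewrite /C/= /w/b pickleK.
    have -> : h b = l by apply/funext => v; rewrite /h/b pickleK.
    have [us|us] := pselect (F s (f u)); first by right; exact: lP.
    by left; exact: mP.
  exists (h b) => s /= us; have [Gu|//] := bP s I; exfalso.
  suff : (~` F s) (f u) by [].
  by rewrite (GP s).2; exists (w b s).
apply: analytic_proj_baire => //; apply: closed_bigI => s _.
pose K (j : nat * seq nat) := f @^-1` G s j.1 `|` g @^-1` F j.2.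
apply: (@closed_locally_constant U _ _ (fun b => (w b s, relabel (h b) s)) K).
  move=> b.
  have hc v (c : baire R) : \forall c' \near c, h c' v = h c v.
    exact: baire_near.
  have wc : \forall c \near b, w c s = w b s by exact: baire_near.
  by apply: filterS2 wc (relabel_locally_constant s hc b) => c -> ->.
move=> j; apply: closedU; apply: preimage_closed.
- by move=> u _; exact: fc.
- by have [+ _] := GP s; exact.
- by move=> u _; exact: gc.
- exact: Fc.
Qed.

(** * The first reflection theorem *)

(** Let [D] be the relation that the tree of [x] maps into the tree of [y]. If
    [Phi] holds of the section of [D] at a point outside [A], then it holds of
    the Borel set, between [A] and that section, given by Lusin separation.
    Otherwise [Phi] holds of exactly the sections at points of [A], which makes
    [A] coanalytic. *)
Theorem first_reflection (R : realType) (T : topologicalType)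
    (Phi : set (set T)) (A : set T) :
  polish R T -> (forall B C, B `<=` C -> Phi C -> Phi B) ->
  (forall D : set (T * T), analytic R D ->
     coanalytic R [set x | Phi [set y | D (x, y)]]) ->
  analytic R A -> Phi A ->
  exists B, [/\ A `<=` B, borel B & Phi B].
Proof.
move=> Tp Phisub PhiD Aa PhiA.
have TH := polish_hausdorff Tp.
have [S SP] := analytic_scheme Aa.
pose F s := closure (S s).
have Fc s : closed (F s) by exact: closed_closure.
have Fdec s k : F (rcons s k) `<=` F s.
  by apply: closureS; exact: scheme_decreasing SP _ _.
have AP x : A x <-> exists a : nat -> nat, forall n, F (mkseq a n) x.
  exact: scheme_closureP.
apply: contrapT => noB.
have AD : A = [set x | Phi [set y | embeds F [::] [::] x y]].
  apply/seteqP; split=> x.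
    move=> Ax; apply: Phisub PhiA => y xy.
    by apply/AP; apply: embeds_branch xy _; exact/AP.
  (* here the section at [x] is shown to contain a Borel enlargement of [A] *)
  move=> /= PhiDx; apply: contrapT => Ax; apply: noB.
  have [||B Bb [AB BE]] := @analytic_separation R T A
      [set y | embeds F [::] [::] y x] TH Aa.
  - exact: (analytic_embeds (g := fun=> x) Tp Tp
             (fun=> cvg_id) (fun=> cvg_cst _) Fc).
  - apply/seteqP; split=> // y [/AP ya yx]; apply: Ax.
    by apply/AP; exact: embeds_branch yx ya.
  exists B; split=> //; apply: Phisub PhiDx => y /BE yx.
  by have [||//] := @embeds_total _ F Fdec x y; rewrite -?AP.
apply: noB; exists A; split=> //.
apply: bianalytic_borel TH Aa _; rewrite [in X in coanalytic _ X]AD.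
apply: (PhiD [set p | embeds F [::] [::] p.1 p.2]).
apply: analytic_embeds Fc => //; first exact: polish_prod.
  by move=> p; exact: cvg_fst.
by move=> p; exact: cvg_snd.
Qed.

(** * Haar-I sets *)

Lemma translate_preimage (Z : Type) (X : zmodType) (f : Z -> X) (A : set X) x :
  f @^-1` translate A x = [set z | A (f z - x)].
Proof.
apply/seteqP; split=> z /= => [[a Aa <-]|Afz]; first by rewrite addrK.
by exists (f z - x) => //; rewrite subrK.
Qed.

Lemma continuous_compT (T U V : topologicalType) (f : T -> U) (g : U -> V) :
  continuous f -> continuous g -> continuous (g \o f).
Proof. by move=> fc gc x; apply: continuous_comp; [exact: fc|exact: gc]. Qed.

Lemma continuous_pair (T U V : topologicalType) (f : T -> U) (g : T -> V) :
  continuous f -> continuous g -> continuous (fun x => (f x, g x)).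
Proof. by move=> fc gc x; apply: cvg_pair; [exact: fc|exact: gc]. Qed.

(** The hypothesis on [I] is applied to the parameter space [X * X], whose
    points are a section index [x] and a translation [v]; the universal
    quantifier over [v] is the complement of a projection. *)
Lemma coanalytic_Haar_witness (R : realType) (Z : topologicalType)
    (I : set (set Z))
    (X : topologicalZmodType) (f : Z -> X) (D : set (X * X)) :
  polish R Z -> polish R X -> Pi11_on_Sigma11 R I -> continuous f ->
  analytic R D ->
  coanalytic R [set x | forall v, I [set z | D (x, f z - v)]].
Proof.
move=> Zp Xp Idef fc [P [g [Pp gc gD]]].
pose N := [set zxv : Z * (X * X) | D (zxv.2.1, f zxv.1 - zxv.2.2)].
have Na : analytic R N.
  (* solving [g p = (x, f z - v)] for [x] and [v] parametrizes [N] by the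
     points [(z, p)] *)
  exists (Z * P)%type, (fun zp => (zp.1, ((g zp.2).1, f zp.1 - (g zp.2).2))).
  split; first exact: polish_prod.
    have fstc (U V : topologicalType) : continuous (@fst U V).
      by move=> p; exact: cvg_fst.
    have sndc (U V : topologicalType) : continuous (@snd U V).
      by move=> p; exact: cvg_snd.
    have gP : continuous (fun zp : Z * P => g zp.2) :=
      continuous_compT (@sndc Z P) gc.
    have fP : continuous (fun zp : Z * P => f zp.1) :=
      continuous_compT (@fstc Z P) fc.
    have g1 := continuous_compT gP (@fstc _ _).
    have g2 := continuous_compT gP (@sndc _ _).
    apply: continuous_pair; first exact: fstc.
    apply: continuous_pair g1 _.
    exact: continuous_compT (continuous_pair fP g2) (@sub_continuous X).
  apply/seteqP; split=> [_ [[z p] _ <-]|[z [x v]] Dxv]; rewrite /N/=.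
    by rewrite subKr -surjective_pairing -gD; exists p.
  move: Dxv; rewrite /N/= -gD => -[p _ gp]; exists (z, p) => //=.
  by rewrite gp /= subKr.
have := Idef (X * X)%type (polish_prod Xp Xp) N Na.
rewrite /coanalytic => /(analytic_image (f := fst)) K.
suff -> : ~` [set x | forall v, I [set z | D (x, f z - v)]] =
    fst @` (~` [set y | I [set z | N (z, y)]]).
  by apply: K => p; exact: cvg_fst.
apply/seteqP; split=> [x /existsNP[v vI]|_ [[x v] vI <-]].
  by exists (x, v).
by apply/existsNP; exists v.
Qed.

Theorem theorem13p14 (R : realType) (Z : topologicalType) (I : set (set Z))
    (Zcompact : compact [set: Z]) (Zmetrizable : metrizable R Z)
    (Isemi : semi_ideal I)
    (Icover : \bigcup_(S in I) S = [set: Z]) (Iproper : ~ I [set: Z])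
    (Idef : Pi11_on_Sigma11 R I)
    (X : topologicalZmodType) (Xpolish : polish R X)
    (Xnlc : ~ locally_compact [set: X])
    (A : set X) (Aanalytic : analytic R A) (AHaar : Haar I A) :
  exists B : set X, [/\ A `<=` B, borel B & Haar I B].
Proof.
have [f fc fA] := AHaar; have [_ Isub] := Isemi.
pose Phi : set (set X) := [set B | forall v, I [set z | B (f z - v)]].
have [||||B [AB Bb PhiB]] := @first_reflection R X Phi A Xpolish.
- by move=> B C BC PhiC v; exact: Isub (fun z => BC (f z - v)) (PhiC v).
- move=> D Da; have Zp := polish_compact Zcompact Zmetrizable.
  exact: coanalytic_Haar_witness Zp Xpolish Idef fc Da.
- by [].
- by move=> v; rewrite -translate_preimage.
- by exists B; split=> //; exists f => // v; rewrite translate_preimage.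
Qed.
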